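(* (1) Let $G$ be one of $D_{2m}$ ($m\ge3$), $T_{4m}$, $U_{(n,m)}$ ($n\ge2$), $SD_{8m}$ with $m\ge3$ odd. Then $\Gamma_G$ is integral iff $m=2a^2+1$ for some integer $a\ge1$. (2) Let $G$ be $D_{2m}$ or $U_{(n,m)}$ ($n\ge 2$) with $m$ even and $m/2$ odd, $m\ge 6$. Then $\Gamma_G$ is integral iff $m=a^2+2$ for some integer $a\ge2$. (3) Let $m\ge4$ with $m$ and $m/2$ even. Then $\Gamma_{D_{2m}}$ is integral iff $4m-7$ is a perfect square. (4) Let $m\ge2$ be even. Then $\Gamma_{T_{4m}}$ is integral iff $8m-7$ is a perfect square, and $\Gamma_{SD_{8m}}$ is integral iff $16m-7$ is a perfect square. (5) For even $m\ge2$, $\Gamma_{V_{8m}}$ is integral iff $8m-7$ is a perfect square; for odd $m\ge3$, $\Gamma_{V_{8m}}$ is integral iff $16m-7$ is a perfect square.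
   Context: Groups: $D_{2m}=\langle x,y\mid x^m=y^2=1,\ yxy^{-1}=x^{-1}\rangle$; $T_{4m}=\langle x,y\mid x^{2m}=1,\ x^m=y^2,\ y^{-1}xy=x^{-1}\rangle$; $SD_{8m}=\langle x,y\mid x^{4m}=y^2=1,\ yxy=x^{2m-1}\rangle$; $U_{(n,m)}=\langle x,y\mid x^{2n}=y^m=1,\ x^{-1}yx=y^{-1}\rangle$; $V_{8m}=\langle x,y\mid x^{2m}=y^4=1,\ yx=x^{-1}y^{-1},\ y^{-1}x=x^{-1}y\rangle$. For a finite non-abelian group $G$ with center $Z(G)$, the NCCC-graph $\Gamma_G$ has vertex set $\{x^G: x\in G\setminus Z(G)\}$ ($x^G$ the conjugacy class of $x$), distinct vertices $x^G,y^G$ adjacent iff $x'y'\neq y'x'$ for all $x'\in x^G,y'\in y^G$. A graph is integral if all eigenvalues of its adjacency matrix are integers. *)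

(* Defs.v *)
From HB Require Import structures.
From mathcomp Require Import all_boot all_order all_algebra all_fingroup all_solvable all_field.
Set Implicit Arguments. Unset Strict Implicit. Unset Printing Implicit Defensive.
Import GRing.Theory Num.Theory.

Local Open Scope group_scope.

Definition is_D2m (gT : finGroupType) (G : {set gT}) (m : nat) : Prop :=
  G \isog Grp (x : y : (x ^+ m, y ^+ 2, y * x * y^-1 = x^-1)).

Definition is_T4m (gT : finGroupType) (G : {set gT}) (m : nat) : Prop :=
  G \isog Grp (x : y : (x ^+ (2 * m), x ^+ m = y ^+ 2, y^-1 * x * y = x^-1)).

Definition is_SD8m (gT : finGroupType) (G : {set gT}) (m : nat) : Prop :=
  G \isog Grp (x : y : (x ^+ (4 * m), y ^+ 2, y * x * y = x ^+ (2 * m - 1))).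

Definition is_Unm (gT : finGroupType) (G : {set gT}) (n m : nat) : Prop :=
  G \isog Grp (x : y : (x ^+ (2 * n), y ^+ m, x^-1 * y * x = y^-1)).

Definition is_V8m (gT : finGroupType) (G : {set gT}) (m : nat) : Prop :=
  G \isog Grp (x : y : (x ^+ (2 * m), y ^+ 4, y * x = x^-1 * y^-1,
                        y^-1 * x = x^-1 * y)).

Definition nccc_vertices (gT : finGroupType) (G : {set gT}) : {set {set gT}} :=
  [set x ^: G | x in G :\: 'Z(G)].

Definition nccc_adj (gT : finGroupType) (C D : {set gT}) : bool :=
  (C != D) && [forall x' in C, forall y' in D, x' * y' != y' * x'].

Local Close Scope group_scope.
Local Open Scope ring_scope.

Definition nccc_adjmx (gT : finGroupType) (G : {set gT})
  : 'M[algC]_#|nccc_vertices G| :=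
  \matrix_(i, j) (nccc_adj (enum_val i) (enum_val j))%:R.

Definition integral_nccc (gT : finGroupType) (G : {set gT}) : Prop :=
  forall a : algC, eigenvalue (nccc_adjmx G) a -> a \in Num.int.

(* Main.v *)
(* Each of these groups has an abelian subgroup A of index 2.  Put z = |Z(G)| and
   s = z / |Z(G) :&: G'|.  The classes inside A \ Z(G) have size 2; the classes
   outside A are the cosets x G', and two of them contain commuting elements iff they
   agree modulo Z(G).  So the NCCC-graph is complete multipartite, with one part of
   size N = (|A| - z) / 2 and all other parts of size s, these covering z vertices.
   Its eigenvalues are 0, possibly -s, and the two roots of t (t - (z - s)) = N z;
   it is therefore integral iff (z - s)^2 + 4 N z is a perfect square.  Every group
   presented here is a split or non-split extension of A by an involution of A, on
   which z and s are computed by elementary arithmetic modulo m. *)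
Require Import Defs.
From HB Require Import structures.
From mathcomp Require Import all_boot all_order all_algebra all_fingroup all_solvable all_field.
From mathcomp Require Import ring zify.
Set Implicit Arguments. Unset Strict Implicit. Unset Printing Implicit Defensive.
Import Order.TTheory GRing.Theory Num.Theory.

(** * Spectrum of a complete multipartite graph *)

Local Open Scope ring_scope.

(** The relations of a presentation bound the order of [G] from above only: they give |G| <= 2 |A|
    but do not exclude a further collapse. The opposite bound needs a group of order exactly 2 |A|
    that satisfies them, which is why explicit models [ext p] are built: [G \isog Grp (...)] maps
    [G] onto the model, and comparing orders turns this surjection into an isomorphism. In the
    model, with p the non-trivial action of y on A, the centre is the kernel of p - 1 and G' is its
    image, so z and s are read off from a kernel and its intersection with an image.

    The quadratic t (t - (z - s)) = N z comes from vectors constant on the part inside A and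
    constant off it: with values u and w there, t u = z w and t w = N u + (z - s) w. Index 2 enters
    through the maximality of A: a noncentral element of A has centralizer A, so its class has size
    2 and is adjacent to every class outside A, and two elements outside A commute only if they
    differ by a central factor. *)

Lemma int_half_root (r q d : nat) (a : algC) :
  (r ^ 2 + 4 * q = d ^ 2)%N -> a * (a - r%:R) = q%:R -> a \in Num.int.
Proof.
move=> rqd aE.
(* The roots are [(r + d) / 2] and [(r - d) / 2]; equal parity of [r] and [d] is what makes them
   integers. *)
have odd_rd : odd r = odd d by move: (congr1 odd rqd); rewrite oddD oddM /= addbF !oddX.
have : (2 * a - r%:R) ^+ 2 = d%:R ^+ 2.
  rewrite -natrX -rqd natrD natrX natrM -aE; ring.
move/eqP; rewrite eqf_sqr => /orP[]/eqP aq.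
  have [e de] : exists e, (r + d = e.*2)%N.
    by exists (r + d)./2; rewrite -[LHS]odd_double_half oddD odd_rd addbb.
  have : 2 * a = 2 * e%:R.
    by rewrite -natrM mul2n -de natrD -aq; ring.
  by move/mulfI => -> //; rewrite pnatr_eq0.
(* Now [2 * a = r - d], of unknown sign; the integer [a] is recorded as a difference [f - e] of
   naturals, one of which is 0. *)
have [e [f def]] : exists e f, (r + e.*2 = d + f.*2)%N.
  case/orP: (leq_total r d) => rd.
    exists (d - r)./2, 0%N; rewrite addn0 -{2}(subnKC rd); congr addn.
    by rewrite -[RHS]odd_double_half oddB // odd_rd addbb.
  exists 0%N, (r - d)./2; rewrite addn0 -{1}(subnKC rd); congr addn.
  by rewrite -[LHS]odd_double_half oddB // odd_rd addbb.
have : 2 * a = 2 * (f%:R - e%:R).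
  have E : r%:R + 2 * e%:R = d%:R + 2 * f%:R :> algC by rewrite -!natrM -!natrD !mul2n def.
  have -> : 2 * a = r%:R + 2 * e%:R - d%:R - 2 * e%:R by rewrite -[d%:R]opprK -aq; ring.
  by rewrite E; ring.
move/mulfI => -> //; last by rewrite pnatr_eq0.
by rewrite rpredB // rpred_nat.
Qed.

(* The parts are the fibres of [c].  An eigenvector for a value other than 0 and [- s]
   is determined by its two sums, over the part [c0] and over its complement. *)
Lemma integral_multipartite (n : nat) (T : eqType) (c : 'I_n -> T) (c0 : T)
    (M : 'M[algC]_n) (N z s : nat) :
    (forall i j, M i j = (c i != c j)%:R) ->
    #|[pred i | c i == c0]| = N -> #|[pred i | c i != c0]| = z ->
    (forall i, c i != c0 -> #|[pred j | c j == c i]| = s) ->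
    (0 < N)%N -> (0 < z)%N ->
  (forall a, eigenvalue M a -> a \in Num.int) <->
  exists d : nat, ((z - s) ^ 2 + 4 * (N * z) = d ^ 2)%N.
Proof.
move=> ME cN cz cs N_gt0 z_gt0.
have le_sz : (s <= z)%N.
  move: (z_gt0); rewrite -{1}cz => /card_gt0P[i]; rewrite inE => ci.
  rewrite -(cs i ci) -cz; apply/subset_leq_card/subsetP => j.
  by rewrite !inE => /eqP->.
set r := (z - s)%N.
have rE : r%:R = z%:R - s%:R :> algC by rewrite natrB.
have zN0 : z%:R != 0 :> algC by rewrite pnatr_eq0 -lt0n.
split=> [intM | [d rqd] a /eigenvalueP[v vM v0]].
- pose D : algC := (r ^ 2 + 4 * (N * z))%:R.
  pose l := (r%:R + sqrtC D) / 2.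
  have lE : l * (l - r%:R) = (N * z)%:R.
    have sE := sqrtCK D; rewrite /l.
    have -> : forall p q : algC, (p + q) / 2 * ((p + q) / 2 - p) = (q ^+ 2 - p ^+ 2) / 4.
      by move=> p q; field.
    rewrite sE /D natrD natrX (natrM _ 4); set q := (N * z)%:R; set p := r%:R; by field.
  have l0 : l != 0.
    apply/negP => /eqP l0; move/eqP: lE.
    by rewrite l0 mul0r eq_sym pnatr_eq0 muln_eq0 !eqn0Ngt N_gt0 z_gt0.
  have /intM/intrP[e le] : eigenvalue M l.
    (* The vector solves t u = z w with u = z and w = t = [l]; the second equation, for columns off
       [c0], is then the quadratic [lE]. *)
    apply/eigenvalueP; exists (\row_i if c i == c0 then z%:R else l); last first.
      move: (N_gt0); rewrite -cN => /card_gt0P[i]; rewrite inE => ci.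
      by apply/negP => /eqP/rowP/(_ i); rewrite !mxE ci; apply/eqP.
    apply/rowP => j; rewrite !mxE.
    under eq_bigr => i _ do rewrite !mxE ME.
    rewrite (bigID (fun i => c i == c0)) /=.
    case: ifPn => [/eqP cj | cj].
      rewrite big1 => [|i /eqP->]; last by rewrite cj eqxx mulr0.
      rewrite add0r (eq_bigr (fun _ => l)) => [|i ci]; last first.
        by rewrite (negPf ci) cj ci mulr1.
      by rewrite sumr_const cz mulr_natr.
    rewrite (eq_bigr (fun _ => z%:R)) => [|i /eqP->]; last by rewrite eqxx eq_sym cj mulr1.
    rewrite sumr_const cN.
    have -> : \sum_(i | c i != c0) (if c i == c0 then z%:R else l) * (c i != c j)%:R
            = \sum_(i | c i != c0) l - \sum_(i | c i == c j) l.
      rewrite [X in _ = X - _](bigID (fun i => c i == c j)) /=.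
      rewrite [X in _ = X + _ - _](eq_bigl (fun i => c i == c j)) => [|i]; last first.
        by case: (c i =P c j) => [->|]; rewrite ?andbF ?andbT.
      rewrite addrC addrA addNr add0r [LHS](bigID (fun i => c i == c j)) /=.
      rewrite big1 ?add0r => [|i /andP[_ /eqP->]]; last by rewrite eqxx mulr0.
      by apply: eq_bigr => i /andP[/negPf-> ->]; rewrite mulr1.
    rewrite !sumr_const cz (cs j cj) -[_ *+ N]mulr_natr -[l *+ z]mulr_natr -[l *+ s]mulr_natr.
    have -> : l * l = l * (l - r%:R) + l * r%:R by ring.
    by rewrite lE rE natrM; ring.
  (* Completing the square shows that [2 * l - r] is a square root of the discriminant; it is an
     integer because [l] is. *)
  exists `|(2 * e - r%:Z)%R|%N; apply/eqP; rewrite -(eqr_nat algC) eq_sym natrX natr_absz intr_norm -normrX; apply/eqP.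
  have -> : (2 * e - r%:Z)%:~R = 2 * l - r%:R :> algC by rewrite le rmorphB rmorphM.
  have -> : (2 * l - r%:R) ^+ 2 = r%:R ^+ 2 + 4 * (l * (l - r%:R)) by ring.
  rewrite lE -natrM -natrX -natrD; apply/eqP; rewrite ger0_norm ?ler0n //.
- have sumM j : a * v 0 j = \sum_i v 0 i - \sum_(i | c i == c j) v 0 i.
    have := congr1 (fun w : 'rV_n => w 0 j) vM; rewrite !mxE => <-.
    rewrite [X in _ = X - _](bigID (fun i => c i == c j)) /= [RHS]addrC addKr.
    rewrite (bigID (fun i => c i == c j)) /= big1 ?add0r => [|i /eqP ij].
      by apply: eq_bigr => i /negPf ij; rewrite ME ij mulr1.
    by rewrite ME ij eqxx mulr0.
  have [-> //|a0] := eqVneq a 0.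
  have vc i j : c i = c j -> v 0 i = v 0 j.
    by move=> ij; apply: (mulfI a0); rewrite !sumM ij.
  have [as0 | as0] := eqVneq (a + s%:R) 0.
    by rewrite (_ : a = - s%:R) ?rpredN ?rpred_nat //; apply/eqP; rewrite -addr_eq0 as0.
  pose Si := \sum_(i | c i == c0) v 0 i; pose So := \sum_(i | c i != c0) v 0 i.
  have SE : \sum_i v 0 i = Si + So by rewrite (bigID (fun i => c i == c0)).
  have vi j : c j == c0 -> a * v 0 j = So.
    by move/eqP=> cj; rewrite sumM cj SE addrC addKr.
  have vo j : c j != c0 -> (a + s%:R) * v 0 j = Si + So.
    move=> cj; rewrite mulrDl sumM SE.
    rewrite (eq_bigr (fun _ => v 0 j)) => [|i /eqP/vc //].
    by rewrite sumr_const (cs j cj) mulr_natl subrK.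
  have aSi : a * Si = N%:R * So.
    by rewrite mulr_sumr (eq_bigr (fun _ => So)) // sumr_const cN mulr_natl.
  have aSo : (a + s%:R) * So = z%:R * (Si + So).
    by rewrite mulr_sumr (eq_bigr (fun _ => Si + So)) // sumr_const cz mulr_natl.
  apply: (int_half_root rqd); rewrite natrM rE.
  (* If [So] vanished, so would [Si], and then every entry of [v]. Hence [So] can be cancelled from
     the quadratic obtained by eliminating [Si]. *)
  have [So0 | So0] := eqVneq So 0.
    have Si0 : Si = 0 by apply: (mulfI a0); rewrite aSi So0 !mulr0.
    case/eqP: v0; apply/rowP => j; rewrite mxE.
    have [/vi|/vo] := boolP (c j == c0); rewrite ?Si0 So0 ?addr0 => /eqP;
      by rewrite mulf_eq0 ?(negPf a0) ?(negPf as0) => /eqP.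
  apply: (mulIf So0).
  have : (a + s%:R - z%:R) * So = z%:R * Si by rewrite mulrBl aSo; ring.
  have -> : a * (a - (z%:R - s%:R)) * So = a * ((a + s%:R - z%:R) * So) by ring.
  by move->; rewrite [N%:R * _]mulrC -[RHS]mulrA -aSi; ring.
Qed.

Local Close Scope ring_scope.

(** * The graph of a group with an abelian subgroup of index 2 *)

Local Open Scope group_scope.

(** Turns counts of vertices into counts of elements. It is applied with class size 2 inside A and
    |K| outside it. *)
Lemma card_classes_uniform (gT : finGroupType) (G : {group gT}) (D : {set gT}) (c : nat) :
    D \subset G -> {in D, forall x, x ^: G \subset D} ->
    {in D, forall x, #|x ^: G| = c} ->
  #|D| = (#|[set x ^: G | x in D]| * c)%N.
Proof.
move=> sDG clD cD; apply: card_uniform_partition; first by move=> _ /imsetP[x Dx ->]; apply: cD.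
have -> : [set x ^: G | x in D] = orbit 'J G @: D by apply: eq_imset => x; rewrite orbitJ.
apply: orbit_partition; apply/actsP => g Gg x; apply/idP/idP => /= Dx.
  have /subsetP := clD _ Dx; rewrite /= classGidl // => /(_ x); apply.
  exact: class_refl.
by have /clD/subsetP/(_ (x ^ g)) := Dx; apply; rewrite memJ_class.
Qed.

Lemma card_enum_val_set (T : finType) (V : {set T}) (P : pred T) :
  #|[pred i : 'I_#|V| | P (enum_val i)]| = #|[set C in V | P C]|.
Proof.
rewrite -(card_imset _ enum_val_inj); apply: eq_card => C; rewrite inE.
apply/imsetP/andP => [[i Pi ->] | [VC PC]]; first by rewrite enum_valP.
by exists (enum_rank_in VC C); rewrite ?inE enum_rankK_in.
Qed.

(** [K] stands for G', but only the shape of the classes outside [A] is asked of it. Since |A| - z =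
    2 N, the term 4 N z of the discriminant becomes 2 z (|A| - z), which no longer mentions the
    graph. *)
Lemma integral_index2 (gT : finGroupType) (G A K : {group gT}) (s : nat) :
    abelian A -> A \subset G -> #|G| = (2 * #|A|)%N -> ~~ abelian G ->
    {in G :\: A, forall x, x ^: G = x *: K} ->
    #|'Z(G)| = (#|'Z(G) :&: K| * s)%N ->
  integral_nccc G <->
  exists d : nat, ((#|'Z(G)| - s) ^ 2 + 2 * #|'Z(G)| * (#|A| - #|'Z(G)|) = d ^ 2)%N.
Proof.
move=> abA sAG oG nabG clK oZ.
set z := #|'Z(G)| in oZ *.
have iGA : #|G : A| = 2 by rewrite -divgS // oG mulnK.
have nAG : A <| G by apply: index2_normal.
(* Index 2 makes [A] maximal; this is applied below to A Z(G) and to centralizers. *)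
have between (H : {group gT}) : A \subset H -> H \subset G -> H :=: A \/ H :=: G.
  move=> sAH sHG.
  have := indexg_gt0 G H; have := Lagrange_index sHG sAH; rewrite iGA => i2 _.
  have : #|H : A| %| 2 by rewrite -i2 dvdn_mull.
  rewrite dvdn_divisors // !inE => /orP[]/eqP oHA; [left | right].
    by apply/eqP; rewrite eqEsubset sAH -indexg_eq1 oHA.
  apply/eqP; rewrite eqEsubset sHG -indexg_eq1; move: i2; rewrite oHA => i2; apply/eqP; lia.
have sZA : 'Z(G) \subset A.
  have [||<-|defG] := between (A <*> 'Z(G))%G; rewrite ?joing_subl ?joing_subr //.
    by rewrite join_subG sAG center_sub.
  case/negP: nabG; rewrite -defG abelianY abA center_abelian.
  by apply: subset_trans (subsetIr _ _) (centS sAG).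
have centA a : a \in A -> a \notin 'Z(G) -> 'C_G[a] = A.
  move=> Aa nZa; have [||//|defG] := between 'C_G[a]%G; rewrite ?subsetIl //.
    by rewrite subsetI sAG sub_cent1 (subsetP abA).
  case/negP: nZa; rewrite inE (subsetP sAG) // -sub_cent1.
  by rewrite -defG subsetIr.
have sdiff x y : x \in G :\: A -> y \in G :\: A -> x^-1 * y \in A.
  move=> Gx; suff -> : G :\: A = x *: A by rewrite mem_lcoset.
  have /setDP[Gx' nAx] := Gx.
  apply/esym/eqP; rewrite eqEcard; apply/andP; split.
    apply/subsetP => _ /lcosetP[a Aa ->].
    by rewrite inE groupMr // nAx groupM // (subsetP sAG).
  by rewrite card_lcoset cardsD (setIidPr sAG) oG mul2n -addnn addnK.
(* If x and y commute, then x commutes with x^-1 y, which lies in A. Were x^-1 y noncentral, its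
   centralizer would be A, which does not contain x. *)
have comm_out x y : x \in G :\: A -> y \in G :\: A -> (x * y == y * x) = (y \in x *: 'Z(G)).
  move=> Gx Gy; rewrite mem_lcoset; have Axy := sdiff x y Gx Gy.
  have [/setDP[Gx' nAx] /setDP[Gy' _]] := (Gx, Gy).
  apply/eqP/idP=> [xy | Zxy].
    apply: contraR nAx => nZ; rewrite -(centA _ Axy nZ) inE Gx'.
    by apply/cent1P; rewrite /commute mulKVg -mulgA -xy mulgA mulVg mul1g.
  have := centerC Gx' Zxy; rewrite /commute mulKVg => E.
  by rewrite [in LHS]E -!mulgA mulKVg.
have comm_in a x : a \in A -> a \notin 'Z(G) -> x \in G :\: A -> a * x != x * a.
  move=> Aa nZ /setDP[Gx nAx]; apply: contra nAx => /eqP ax.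
  by rewrite -(centA _ Aa nZ) inE Gx; apply/cent1P.
have clA a : a \in G -> (a ^: G \subset A) = (a \in A).
  move=> Ga; apply/subsetP/idP => [|Aa _ /imsetP[g Gg ->]]; first by apply; rewrite class_refl.
  by rewrite memJ_norm // (subsetP (normal_norm nAG)).
have clZ a : a \in G -> {in a ^: G, forall b, (b \in 'Z(G)) = (a \in 'Z(G))}.
  move=> Ga _ /imsetP[g Gg ->].
  by rewrite memJ_norm // (subsetP (normal_norm (center_normal G))).
have sKG : K \subset G.
  have [x Gx] : exists x, x \in G :\: A.
    by apply/set0Pn; rewrite setD_eq0 -indexg_gt1 iGA.
  have := class_subG (subsetP (subsetDl _ _) x Gx) (subxx G).
  rewrite clK // => /subsetP sxK; apply/subsetP => k Kk; have /setDP[Gx' _] := Gx.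
  by rewrite -(groupMl k Gx') sxK // mem_lcoset mulKg.
have ZK : commute 'Z(G) K.
  by apply/centC/(subset_trans (subsetIr _ _))/centS.
(* The label whose fibres are the parts. Outside [A] it is a coset of Z(G) K, hence never equal to
   [A]. *)
pose c (C : {set gT}) := if C \subset A then A : {set gT} else C * 'Z(G).
have clO x y : x \in G :\: A -> y \in x ^: G -> y \in G :\: A.
  case/setDP=> Gx nAx xy; have Gy := subsetP (class_subG Gx (subxx G)) y xy.
  by rewrite inE Gy -clA // (class_eqP xy) clA // nAx.
have cx x y : x \in G :\: A -> y \in x ^: G -> c (x ^: G) = y *: ('Z(G) <*> K).
  move=> Gx xy; have Gy := clO x y Gx xy.
  rewrite -(class_eqP xy) /c clA; last by case/setDP: Gy.
  case/setDP: (Gy) => _ /negPf->.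
  by rewrite clK // comm_joingE // ZK mulgA.
have cA x : x \in A -> c (x ^: G) = A by move=> Ax; rewrite /c clA ?Ax ?(subsetP sAG).
have cnA x : x \in G :\: A -> c (x ^: G) != A.
  move=> Gx; have /setDP[_ nAx] := Gx; apply: contra nAx => /eqP <-.
  by rewrite (cx x x) ?class_refl ?lcoset_refl.
have adjE C D : C \in nccc_vertices G -> D \in nccc_vertices G -> nccc_adj C D = (c C != c D).
  case/imsetP=> x /setDP[Gx nZx] ->{C} /imsetP[y /setDP[Gy nZy] ->{D}].
  have inout a b : a \in A -> a \notin 'Z(G) -> b \in G :\: A ->
      {in a ^: G & b ^: G, forall a' b', a' * b' != b' * a'}.
    move=> Aa nZa Gb a' b' aa' bb'; have Ga := subsetP sAG a Aa.
    apply: comm_in (clO b b' Gb bb'); last by rewrite (clZ a Ga).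
    by have := Aa; rewrite -clA // => /subsetP->.
  have [Ax|nAx] := boolP (x \in A); have [Ay|nAy] := boolP (y \in A).
  - rewrite !cA // eqxx; apply: contraTF isT => /andP[_ /forallP/(_ x)].
    rewrite class_refl /= => /forallP/(_ y); rewrite class_refl /=.
    by rewrite (centsP abA) ?eqxx.
  - have Gy' : y \in G :\: A by rewrite inE nAy.
    rewrite cA // eq_sym cnA //; apply/andP; split.
      by apply: contraNneq (cnA y Gy') => <-; rewrite cA.
    apply/forallP => x'; apply/implyP => xx'; apply/forallP => y'; apply/implyP => yy'.
    exact: inout xx' yy'.
  - have Gx' : x \in G :\: A by rewrite inE nAx.
    rewrite (cA y) // cnA //; apply/andP; split.
      by apply: contraNneq (cnA x Gx') => ->; rewrite cA.
    apply/forallP => x'; apply/implyP => xx'; apply/forallP => y'; apply/implyP => yy'.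
    by rewrite eq_sym; apply: inout yy' xx'.
  - have Gx' : x \in G :\: A by rewrite inE nAx.
    have Gy' : y \in G :\: A by rewrite inE nAy.
    apply/andP/idP=> [[_ /forallP xy] | nxy].
      apply/eqP => exy.
      have : y \in c (x ^: G) by rewrite exy (cx y y) ?class_refl ?lcoset_refl.
      rewrite /c clA // (negPf nAx) => /mulsgP[x' u xx' Zu yE].
      have /implyP/(_ xx')/forallP/(_ y) := xy x'; rewrite class_refl /=.
      by rewrite comm_out ?(clO x x') // yE mem_lcoset mulKg Zu.
    split; first by apply: contraNneq nxy => ->.
    apply/forallP => x'; apply/implyP => xx'; apply/forallP => y'; apply/implyP => yy'.
    rewrite comm_out ?(clO x x') ?(clO y y') //; apply: contra nxy => xy.
    rewrite (cx x x') // (cx y y') //; apply/eqP/lcoset_eqP.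
    by move: xy; rewrite lcoset_sym !mem_lcoset; apply/subsetP/joing_subl.
(* Orbit-stabilizer for x outside A: the centralizer is the union of Z(G) and x Z(G), of order 2 z,
   and the class has |K| elements, so 2 z |K| = 2 |A|. *)
have oK x : x \in G :\: A -> (#|K| * z = #|A|)%N.
  move=> Gx; have /setDP[Gx' nAx] := Gx.
  have CA : 'C_G[x] :&: A = 'Z(G).
    apply/eqP; rewrite eqEsubset subsetI sZA andbT; apply/andP; split.
      apply/subsetP => a /setIP[/setIP[Ga /cent1P ax] Aa]; apply: contraT => nZ.
      by have := comm_in a x Aa nZ Gx; rewrite ax eqxx.
    apply/subsetP => a Za; rewrite inE (subsetP (center_sub G)) //=.
    exact/cent1P/commute_sym/(centerC Gx' Za).
  have CD : 'C_G[x] :\: A = x *: 'Z(G).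
    apply/setP => y; have [Gy|nGy] := boolP (y \in G :\: A).
      rewrite -comm_out //; have /setDP[Gy' nAy] := Gy.
      by rewrite in_setD nAy in_setI Gy' /= (sameP cent1P eqP) eq_sym.
    have -> : (y \in 'C_G[x] :\: A) = false.
      by apply: contraNF nGy; rewrite !inE => /andP[-> /andP[->]].
    apply/esym; apply: contraNF nGy => /lcosetP[u Zu ->].
    by rewrite inE (groupMr _ (subsetP sZA u Zu)) nAx groupM // (subsetP (center_sub G)).
  have oC : #|'C_G[x]| = (z + z)%N by rewrite -(cardsID A) CA CD card_lcoset.
  have := Lagrange (subsetIl G 'C[x]).
  rewrite oC index_cent1 clK // card_lcoset oG addnn -mul2n -mulnA => /eqP.
  by rewrite eqn_pmul2l // mulnC => /eqP.
have [x0 Gx0] : exists x, x \in G :\: A.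
  by apply/set0Pn; rewrite setD_eq0 -indexg_gt1 iGA.
have {}oK := oK x0 Gx0.
pose N := #|[set C in nccc_vertices G | c C == A]|.
have oN : (#|A| = z + N * 2)%N.
  rewrite -(cardsID 'Z(G)) (setIidPr sZA); congr addn.
  rewrite (card_classes_uniform (G := G) (D := A :\: 'Z(G)) (c := 2)); last 1 first.
  - move=> a /setDP[Aa nZ]; rewrite -index_cent1 centA //.
  - congr (_ * _)%N; apply: eq_card => C; rewrite inE; apply/imsetP/andP.
      case=> a /setDP[Aa nZ] ->; rewrite cA //; split=> //.
      by apply: imset_f; rewrite inE nZ (subsetP sAG).
    case=> /imsetP[a /setDP[Ga nZ] ->] /eqP ca; exists a => //; rewrite inE nZ.
    by apply: contraT => nAa; have := cnA a; rewrite inE nAa Ga ca eqxx => /(_ isT).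
  - by rewrite (subset_trans (subsetDl _ _)).
  - move=> a /setDP[Aa nZ]; apply/subsetP => b ab; have Ga := subsetP sAG a Aa.
    by rewrite inE (clZ a) // nZ; move: b ab; apply/subsetP; rewrite clA.
have sO : G :\: A \subset G := subsetDl _ _.
have VO x : x \in G :\: A -> x ^: G \in nccc_vertices G.
  by case/setDP=> Gx nAx; apply: imset_f; rewrite inE Gx (contra (subsetP sZA x)).
have K_gt0 := cardG_gt0 K.
have oO : #|[set C in nccc_vertices G | c C != A]| = z.
  apply/eqP; rewrite -(eqn_pmul2r K_gt0) [(z * _)%N]mulnC oK.
  have <- : #|G :\: A| = #|A| by rewrite cardsD (setIidPr sAG) oG mul2n -addnn addnK.
  rewrite (card_classes_uniform (G := G) (D := G :\: A) (c := #|K|)) //; last 2 first.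
  - by move=> x Gx; apply/subsetP => y /(clO x y Gx).
  - by move=> x Gx; rewrite clK // card_lcoset.
  apply/eqP; congr (_ * _)%N; apply: eq_card => C; rewrite inE; apply/andP/imsetP.
    case=> /imsetP[x /setDP[Gx nZ] ->] cC; exists x => //; rewrite inE Gx andbT.
    by apply: contra cC => /cA->.
  by case=> x Gx ->; rewrite cnA ?VO.
have oS C : C \in nccc_vertices G -> c C != A ->
    #|[set D in nccc_vertices G | c D == c C]| = s.
  case/imsetP=> x /setDP[Gx nZ] ->{C} cC.
  have {}Gx : x \in G :\: A by rewrite inE Gx andbT; apply: contra cC => /cA->.
  apply/eqP; rewrite -(eqn_pmul2r K_gt0).
  (* [X] is the union of the classes in the part of x. It has |Z(G) K| = z |K| / |Z(G) :&: K| = s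
     |K| elements, and each class takes |K| of them. *)
  pose X : {set gT} := x *: ('Z(G) <*> K).
  have -> : (s * #|K| = #|X|)%N.
    rewrite card_lcoset; apply/eqP; rewrite -(eqn_pmul2r (cardG_gt0 ('Z(G) :&: K))).
    by rewrite comm_joingE // -mul_cardG -/z oZ mulnAC (mulnC s).
  have sub : X \subset G :\: A.
    apply/subsetP => y xy; have := cx x x Gx (class_refl _ _).
    rewrite /c clA; last by case/setDP: Gx.
    have /setDP[_ /negPf->] := Gx => E; move: xy; rewrite /X -E => /mulsgP[x' u xx' Zu ->].
    have /setDP[Gx' nAx'] := clO x x' Gx xx'.
    by rewrite inE (groupMr _ (subsetP sZA u Zu)) nAx' groupM // (subsetP (center_sub G)).
  have cE y : y \in G :\: A -> (c (y ^: G) == c (x ^: G)) = (y \in X).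
    move=> Gy; rewrite (cx y y) ?(cx x x) ?class_refl // /X.
    by apply/eqP/idP => [<-|/lcoset_eqP//]; apply: lcoset_refl.
  rewrite (card_classes_uniform (G := G) (D := X) (c := #|K|)) //; last 3 first.
  - exact: subset_trans sO.
  - move=> y xy; have Gy := subsetP sub y xy; apply/subsetP => y' yy'.
    by rewrite -cE ?(clO y y') // (class_eqP yy') cE.
  - by move=> y /(subsetP sub) Gy; rewrite clK // card_lcoset.
  apply/eqP; congr (_ * _)%N; apply: eq_card => D; rewrite inE; apply/andP/imsetP.
    case=> /imsetP[y /setDP[Gy nZy] ->] cD; exists y => //; rewrite -cE // inE Gy andbT.
    by apply: contra cC => /cA; rewrite (eqP cD) => ->.
  by case=> y xy ->; rewrite VO ?cE ?(subsetP sub).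
(* If no class lay in the part of [A], then A = Z(G) would centralize [x0]; the centralizer of [x0],
   larger than [A], would be G, and [x0] would be central, hence in [A]. *)
have N_gt0 : (0 < N)%N.
  rewrite lt0n; apply: contra nabG => /eqP N0; move: oN; rewrite N0 addn0 => oA.
  have ZA : 'Z(G) = A by apply/eqP; rewrite eqEcard sZA oA leqnn.
  have /setDP[Gx nAx] := Gx0; case/negP: nAx.
  have [||E|E] := between 'C_G[x0]%G; rewrite ?subsetIl //.
  - rewrite subsetI sAG -ZA; apply/subsetP => a Za.
    exact/cent1P/commute_sym/(centerC Gx Za).
  - by rewrite -E inE Gx; apply/cent1P.
  - by rewrite -ZA inE Gx -sub_cent1 -E subsetIr.
have cin := @card_enum_val_set _ (nccc_vertices G) (fun C => c C == A).
have cout := @card_enum_val_set _ (nccc_vertices G) (fun C => c C != A).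
rewrite oO in cout.
apply: iff_trans (integral_multipartite (s := s) _ cin cout _ N_gt0 (cardG_gt0 _)) _.
- by move=> i j; rewrite mxE adjE ?enum_valP.
- move=> i ci; rewrite (card_enum_val_set _ (fun C => c C == c (enum_val i))).
  by rewrite oS ?enum_valP.
- by rewrite oN addKn (_ : 2 * z * (N * 2) = 4 * (N * z))%N //; lia.
Qed.

Local Close Scope group_scope.

(** * Extensions of an abelian group by an involution *)

Local Open Scope ring_scope.

(** The data of an extension by y with y^2 in the base: y^2 acts trivially on the abelian base,
    whence [twK], and y commutes with its own square, whence [tw_fix]. *)
Record twist (V : finZmodType) := Twist {
  tw_fun :> V -> V;
  tw_sq : V;
  twD : {morph tw_fun : a b / a + b};
  twK : involutive tw_fun;
  tw_fix : tw_fun tw_sq = tw_sq }.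

(* [(a, b)] stands for a y^b, where y^2 = [tw_sq p] and y a y^-1 = [p a]. *)
Definition ext (V : finZmodType) (p : twist V) : Type := (V * bool)%type.

Section Ext.
Variables (V : finZmodType) (p : twist V).

Definition ext_mul (u v : ext p) : ext p :=
  (u.1 + (if u.2 then p v.1 else v.1) + (if u.2 && v.2 then tw_sq p else 0), u.2 (+) v.2).
Definition ext_inv (u : ext p) : ext p :=
  (if u.2 then - p u.1 - tw_sq p else - u.1, u.2).

Lemma tw0 : p 0 = 0.
Proof. by apply: (addrI (p 0)); rewrite -twD !addr0. Qed.

Lemma twN : {morph p : a / - a}.
Proof. by move=> a; apply: (addrI (p a)); rewrite -twD !subrr tw0. Qed.

Lemma ext_mulA : associative ext_mul.
Proof.
move=> [a i] [b j] [c k]; rewrite /ext_mul /= addbA; congr (_, _).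
case: i j k => [] [] []; rewrite /= ?addr0 ?twD ?twK ?tw_fix ?tw0 ?addr0 -?addrA //.
- by congr (_ + (_ + _)); rewrite addrC.
- by congr (_ + (_ + _)); rewrite addrC.
Qed.

Lemma ext_mul1 : left_id ((0, false) : ext p) ext_mul.
Proof. by case=> a i; rewrite /ext_mul /= add0r addr0. Qed.

Lemma ext_mulV : left_inverse ((0, false) : ext p) ext_inv ext_mul.
Proof.
case=> a i; rewrite /ext_mul /ext_inv /= addbb; congr (_, _).
by case: i; rewrite /= ?addr0 ?addNr // addrAC addrNK ?addNr.
Qed.

HB.instance Definition _ := Finite.copy (ext p) (V * bool)%type.
HB.instance Definition _ := Finite_isGroup.Build (ext p) ext_mulA ext_mul1 ext_mulV.

Local Open Scope group_scope.

Lemma ext_mulE (u v : ext p) : u * v =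
  (u.1 + (if u.2 then p v.1 else v.1) + (if u.2 && v.2 then tw_sq p else 0), u.2 (+) v.2)%R.
Proof. by []. Qed.

Lemma ext_invE (u : ext p) : u^-1 = (if u.2 then - p u.1 - tw_sq p else - u.1, u.2)%R.
Proof. by []. Qed.

Lemma card_ext : #|[set: ext p]| = (2 * #|V|)%N.
Proof. by rewrite cardsT card_prod card_bool mulnC. Qed.

Definition ext_base := [set ((a, false) : ext p) | a : V].
Definition ext_comm := [set ((p a - a, false)%R : ext p) | a : V].

Lemma ext_baseP (u : ext p) : (u \in ext_base) = ~~ u.2.
Proof.
case: u => a i; apply/imsetP/idP => [[b _ [_ ->]]//|/= /negPf->].
by exists a.
Qed.

Lemma ext_base_group_set : group_set ext_base.
Proof.
apply/group_setP; split; first by rewrite ext_baseP.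
by move=> u v; rewrite !ext_baseP ext_mulE /=; case: u.2; case: v.2.
Qed.
Canonical ext_base_group := Group ext_base_group_set.

Lemma ext_comm_group_set : group_set ext_comm.
Proof.
apply/group_setP; split; first by apply/imsetP; exists 0%R; rewrite ?tw0 ?subrr.
move=> _ _ /imsetP[a _ ->] /imsetP[b _ ->]; apply/imsetP; exists (a + b)%R => //.
by rewrite ext_mulE /= twD opprD addr0 addrACA.
Qed.
Canonical ext_comm_group := Group ext_comm_group_set.

Lemma card_ext_base : #|ext_base| = #|V|.
Proof. by rewrite card_imset // => a b []. Qed.

Lemma ext_base_abelian : abelian ext_base.
Proof.
apply/centsP => _ /imsetP[a _ ->] _ /imsetP[b _ ->].
by rewrite /commute !ext_mulE /= [(a + b)%R]addrC.
Qed.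

(** Conjugating (a, true) by (b, false) gives a + (p b - b), and conjugating by y gives p a = a + (p
    a - a): both stay in one coset of the image of p - 1, and the first kind already fills it. *)
Lemma ext_class (u : ext p) : u \notin ext_base -> u ^: [set: ext p] = u *: ext_comm.
Proof.
case: u => a i; rewrite ext_baseP /= negbK => ->.
apply/setP => v; apply/imsetP/lcosetP => [[[b j] _ ->] | [_ /imsetP[b _ ->] ->]].
  exists ((p (if j then b - a else - b) - (if j then b - a else - b))%R, false).
    by apply/imsetP; eexists.
  rewrite conjgE !ext_mulE ext_invE /=; case: j => /=; congr (_, _);
    rewrite !twD !twN ?twK ?addr0 ?twD ?twN ?twK ?tw_fix.
  - rewrite addrACA addNr addr0 addrC -addrA addrCA.
    by rewrite [(b - a - _)%R]addrAC [RHS]addrC subrK opprB.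
  - by rewrite opprK addrCA.
exists (- b, false)%R; first exact: in_setT.
rewrite conjgE !ext_mulE ext_invE /=; congr (_, _).
rewrite !twD !twN ?twK ?addr0.
by rewrite opprK addrCA.
Qed.

Hypothesis p_neq : exists a, p a != a.

Lemma ext_nabelian : ~~ abelian [set: ext p].
Proof.
have [a pa] := p_neq; apply: contra pa => /centsP/(_ ((0, true)%R : ext p) (in_setT _)).
move=> /(_ (a, false) (in_setT _)); rewrite /commute !ext_mulE /= add0r !addr0.
by case=> ->.
Qed.

Lemma ext_center : 'Z([set: ext p]) = [set ((a, false) : ext p) | a in [pred a | p a == a]].
Proof.
have [b pb] := p_neq.
apply/setP => -[a i]; apply/centerP/imsetP => [[_ ca] | [c /eqP pc [-> ->]]].
  have := ca (b, false) (in_setT _); rewrite /commute !ext_mulE /= andbF addbF !addr0.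
  case: i ca => ca.
    by case; rewrite addrC => /addIr/eqP; rewrite (negPf pb).
  move=> _; have := ca (0, true)%R (in_setT _).
  rewrite /commute !ext_mulE /= !addr0 add0r => -[pa]; exists a => //.
  by rewrite inE -pa.
split=> [|[d j] _]; first exact: in_setT.
by rewrite /commute !ext_mulE /= andbF addbF !addr0; case: j; rewrite ?pc addrC.
Qed.

End Ext.

Local Open Scope group_scope.

(** Everything left to compute lives in [V]: [z] counts the kernel of p - 1, and [k] the part of
    that kernel lying in the image of p - 1. *)
Lemma integral_ext (V : finZmodType) (p : twist V) (gT : finGroupType) (G : {group gT})
    (z k s : nat) :
    [set: ext p] \isog G -> (exists a, p a != a) ->
    #|[set a | p a == a]| = z -> #|[set a | (p a == a) && [exists b, a == p b - b]%R]| = k ->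
    z = (k * s)%N ->
  integral_nccc G <-> exists d : nat, ((z - s) ^ 2 + 2 * z * (#|V| - z) = d ^ 2)%N.
Proof.
move=> /isogP[f injf fG] p_neq oz ok zks.
have sub (H : {group ext p}) : H \subset [set: ext p] := subsetT _.
have oZ : #|'Z(G)| = z.
  rewrite -fG -injm_center // card_injm ?subsetT // ext_center // card_imset => [|a b []//].
  by rewrite -oz; apply: eq_card => a; rewrite !inE.
have oZK : #|'Z(G) :&: f @* ext_comm p| = k.
  rewrite -fG -injm_center // -injmI ?subsetT // card_injm ?subsetT // ext_center // -ok.
  rewrite -(card_imset _ (f := fun a : V => (a, false) : ext p)) => [|a b []//].
  apply: eq_card => u; apply/setIP/imsetP.
    case=> /imsetP[a pa ->] /imsetP[b _ [ab]]; exists a => //.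
    by rewrite inE; apply/andP; split; [exact: pa | apply/existsP; exists b; rewrite ab].
  case=> a; rewrite inE => /andP[pa /existsP[b /eqP ab]] ->.
  by split; apply/imsetP; [exists a | exists b; rewrite -?ab].
rewrite -oZ -(card_ext_base p) -(card_injm injf (subsetT (ext_base p))).
apply: (integral_index2 (A := f @* ext_base p) (K := f @* ext_comm p)).
- exact/morphim_abelian/ext_base_abelian.
- by rewrite -fG morphimS // subsetT.
- by rewrite -fG !card_injm ?subsetT // card_ext card_ext_base.
- by rewrite -fG injm_abelian // ext_nabelian.
- rewrite -fG -morphimDG ?(subset_trans injf (sub1G _)) // => _ /morphimP[u _ /setDP[_ nu] ->].
  by rewrite -morphim_class ?inE // ext_class // morphimMl ?morphim_set1 ?sub1set ?inE.
- by rewrite oZ oZK.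
Qed.

(** The cosets H and H y cover the group generated. This is the upper bound on |G| that the
    relations provide. *)
Lemma leq_card_joing_index2 (gT : finGroupType) (H : {group gT}) (y : gT) :
  y \in 'N(H) -> y ^+ 2 \in H -> (#|H <*> <[y]>| <= 2 * #|H|)%N.
Proof.
move=> nHy y2; have nHY : <[y]> \subset 'N(H) by rewrite cycle_subG.
have sub : H <*> <[y]> \subset H :|: H :* y.
  rewrite norm_joinEr //; apply/subsetP => _ /mulsgP[h _ Hh /cycleP[i ->] ->].
  rewrite -[i]odd_double_half addnC -mul2n expgD expgM mulgA inE mem_rcoset.
  have Hi : h * (y ^+ 2) ^+ i./2 \in H by apply: groupM Hh (groupX _ y2).
  by case: odd; rewrite /= ?expg1 ?mulgK ?Hi ?orbT // expg0 mulg1 Hi.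
apply: leq_trans (subset_leq_card sub) _.
by apply: leq_trans (leq_card_setU _ _) _; rewrite card_rcoset mul2n addnn.
Qed.

Local Close Scope group_scope.
Local Close Scope ring_scope.

(** * Cyclic base *)

Local Open Scope ring_scope.

Lemma Zp_natr_eq0 (q n : nat) : (1 < q)%N -> (n%:R == 0 :> 'Z_q) = (q %| n)%N.
Proof. by move=> q1; rewrite Zp_nat -val_eqE /= Zp_cast. Qed.

Lemma Zp_natr_eq (q m n : nat) : (1 < q)%N ->
  (m%:R == n%:R :> 'Z_q) = (m == n %[mod q])%N.
Proof. by move=> q1; rewrite !Zp_nat -val_eqE /= Zp_cast. Qed.

Lemma card_ord_Zp (q : nat) : (1 < q)%N -> #|'Z_q| = q.
Proof. by move=> q1; rewrite card_ord Zp_cast. Qed.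

Lemma card_Zp_dvdn (q d : nat) : (1 < q)%N -> (d %| q)%N ->
  #|[set a : 'Z_q | (d %| a)%N]| = (q %/ d)%N.
Proof.
move=> q1 dq; have d0 : (0 < d)%N by apply: dvdn_gt0 dq; lia.
have lt_q (i : 'I_(q %/ d)) : (i * d < q)%N.
  by rewrite -{2}(divnK dq) ltn_mul2r d0 ltn_ord.
have valE (i : 'I_(q %/ d)) : val ((i * d)%:R : 'Z_q) = (i * d)%N.
  by rewrite Zp_nat /= Zp_cast // modn_small.
transitivity #|[set ((i * d)%:R : 'Z_q) | i : 'I_(q %/ d)]|; last first.
  rewrite card_imset ?card_ord // => i j /(congr1 val); rewrite !valE => /eqP.
  by rewrite eqn_pmul2r // => /eqP/val_inj.
apply: eq_card => a; rewrite inE; apply/idP/imsetP => [da | [i _ ->]]; last first.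
  by rewrite valE dvdn_mull.
have ltaq : (a < q)%N by have := ltn_ord a; rewrite [X in (_ < X)%N]Zp_cast.
have lt_i : (a %/ d < q %/ d)%N by rewrite ltn_divLR // divnK.
by exists (Ordinal lt_i) => //=; rewrite divnK // natr_Zp.
Qed.

Lemma dvdn_mul_gcd (q c n : nat) : (0 < q)%N -> (q %| c * n)%N = (q %/ gcdn c q %| n)%N.
Proof.
move=> q0; have g0 : (0 < gcdn c q)%N by rewrite gcdn_gt0 q0 orbT.
have := muln_gcdl (c %/ gcdn c q)%N (q %/ gcdn c q)%N (gcdn c q).
rewrite !divnK ?dvdn_gcdl ?dvdn_gcdr // => gE.
rewrite -{1}(divnK (dvdn_gcdr c q)) -{3}(divnK (dvdn_gcdl c q)) mulnAC dvdn_pmul2r //.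
rewrite Gauss_dvdr // coprime_sym /coprime -(eqn_pmul2r g0) mul1n.
by rewrite gE.
Qed.

Lemma Zp_ker_mul (q c : nat) (a : 'Z_q) : (1 < q)%N ->
  (c%:R * a == 0) = (q %/ gcdn c q %| a)%N.
Proof.
move=> q1; rewrite -{1}[a]natr_Zp -natrM Zp_natr_eq0 // dvdn_mul_gcd //; lia.
Qed.

Lemma Zp_im_mul (q c : nat) (a : 'Z_q) : (1 < q)%N ->
  [exists b : 'Z_q, a == c%:R * b] = (gcdn c q %| a)%N.
Proof.
move=> q1; apply/existsP/idP => [[b /eqP ->] | ga].
  rewrite -[b]natr_Zp; move: (nat_of_ord b) => n; rewrite -natrM Zp_nat /= Zp_cast //.
  rewrite /dvdn modn_dvdm ?dvdn_gcdr //; apply: dvdn_mulr; exact: dvdn_gcdl.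
have q0 : (0 < q)%N by lia.
(* This form of Bezout says that [q] divides [gcdn q c + u * c], which explains the sign of the
   witness. *)
have [u _ qu] := Bezoutl c q0; exists (- u%:R * (a %/ gcdn c q)%:R).
have : (gcdn q c)%:R = - (u%:R * c%:R) :> 'Z_q.
  by apply/eqP; rewrite -addr_eq0 -natrM -natrD Zp_natr_eq0.
rewrite gcdnC => E; apply/eqP.
rewrite -[LHS]natr_Zp -{1}(divnK ga) natrM E; ring.
Qed.

Section CyclicTwist.
Variables (q c e : nat).
Hypothesis q_gt1 : (1 < q)%N.
Hypothesis cK : (c.+1 * c.+1 = 1 %[mod q])%N.
Hypothesis ce : (q %| c * e)%N.

(** With multiplier [c.+1], the map p - 1 is multiplication by [c], so its kernel and image are
    governed by [gcdn c q]. The element [e] is the exponent in y^2 = x^e, and [ce] says that it is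
    fixed. *)
Let cmul (a : 'Z_q) := c.+1%:R * a.

Fact cyc_twistD : {morph cmul : a b / a + b}. Proof. by move=> a b; apply: mulrDr. Qed.
Fact cyc_twistK : involutive cmul.
Proof.
move=> a; rewrite /cmul mulrA -natrM -[RHS]mul1r; congr (_ * _).
by apply/eqP; rewrite (Zp_natr_eq _ 1) // cK.
Qed.
Fact cyc_twist_fix : cmul e%:R = e%:R.
Proof.
rewrite /cmul -natr1 mulrDl mul1r -natrM; apply/eqP; rewrite -subr_eq0 addrK.
by rewrite Zp_natr_eq0.
Qed.
Definition cyc_twist : twist 'Z_q := Twist cyc_twistD cyc_twistK cyc_twist_fix.

Lemma cyc_fixE (a : 'Z_q) : (cyc_twist a == a) = (q %/ gcdn c q %| a)%N.
Proof. by rewrite -Zp_ker_mul // -subr_eq0 /= /cmul -natr1 mulrDl mul1r addrK. Qed.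

Lemma cyc_imE (a : 'Z_q) : [exists b, a == cyc_twist b - b] = (gcdn c q %| a)%N.
Proof.
rewrite -Zp_im_mul //; apply: eq_existsb => b.
by rewrite /= /cmul -natr1 mulrDl mul1r addrK.
Qed.

Lemma card_cyc_fix : #|[set a | cyc_twist a == a]| = gcdn c q.
Proof.
have q0 : (0 < q)%N by lia.
transitivity #|[set a : 'Z_q | (q %/ gcdn c q %| a)%N]|.
  by apply: eq_card => a; rewrite !inE cyc_fixE.
by rewrite card_Zp_dvdn ?dvdn_div ?dvdn_gcdr // divnA ?dvdn_gcdr // mulKn.
Qed.

(** With g = [gcdn c q], the kernel consists of the multiples of q / g and the image of the
    multiples of g, so they meet in the multiples of the lcm; as g (q / g) = q, there are gcd(g, q /
    g) of these. *)
Lemma card_cyc_fix_im :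
  #|[set a | (cyc_twist a == a) && [exists b, a == cyc_twist b - b]]|
    = gcdn (gcdn c q) (q %/ gcdn c q)%N.
Proof.
have q0 : (0 < q)%N by lia.
set g := gcdn c q; have gq : (g %| q)%N by apply: dvdn_gcdr.
have lq : (lcmn g (q %/ g) * gcdn g (q %/ g) = q)%N by rewrite muln_lcm_gcd mulnC divnK.
transitivity #|[set a : 'Z_q | (lcmn g (q %/ g) %| a)%N]|.
  by apply: eq_card => a; rewrite !inE cyc_fixE cyc_imE dvdn_lcm andbC.
have dvd_l : (lcmn g (q %/ g) %| q)%N by rewrite -[X in (_ %| X)%N]lq dvdn_mulr.
by rewrite card_Zp_dvdn // -{1}lq mulKn // (dvdn_gt0 q0 dvd_l).
Qed.

End CyclicTwist.

Local Open Scope group_scope.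

Lemma ext_gen (V : finZmodType) (p : twist V) (H : {group ext p}) (b : V) :
  (forall a, ((a, false) : ext p) \in H) -> ((b, true) : ext p) \in H -> H = [set: ext p] :> {set _}.
Proof.
move=> HA Hb; apply/eqP; rewrite eqEsubset subsetT; apply/subsetP => -[a []] _ //.
have -> : ((a, true) : ext p) = (((a - b)%R, false) : ext p) * ((b, true) : ext p).
  by rewrite ext_mulE /= addr0 subrK.
by rewrite groupM.
Qed.

Lemma ext_expg (V : finZmodType) (p : twist V) (a : V) (n : nat) :
  ((a, false) : ext p) ^+ n = ((a *+ n)%R, false).
Proof. by elim: n => // n IHn; rewrite expgS IHn ext_mulE /= addr0 mulrS. Qed.

Lemma cyc_gen (q : nat) (p : twist 'Z_q) :
  <[((1, false)%R : ext p)]> <*> <[((0, true)%R : ext p)]> = [set: ext p].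
Proof.
apply: (ext_gen (b := 0%R)) => [a|]; last by rewrite mem_gen // inE cycle_id orbT.
have -> : (a, false) = ((1, false)%R : ext p) ^+ a by rewrite ext_expg natr_Zp.
by rewrite mem_gen // inE mem_cycle.
Qed.

(** The surjection onto the model gives |G| >= 2 q and the relations give |G| <= 2 q, so [G] is the
    model. That [q] does not divide [c] makes the twist non-trivial. *)
Lemma integral_cyclic (q c e : nat) (q_gt1 : (1 < q)%N)
    (cK : (c.+1 * c.+1 = 1 %[mod q])%N) (ce : (q %| c * e)%N)
    (gT : finGroupType) (G : {group gT}) (x y : gT) (s : nat) :
    ~~ (q %| c)%N ->
    [set: ext (cyc_twist q_gt1 cK ce)] \homg G ->
    <[x]> <*> <[y]> = G -> x ^+ q = 1 -> y ^+ 2 = x ^+ e -> y * x * y^-1 = x ^+ c.+1 ->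
    gcdn c q = (gcdn (gcdn c q) (q %/ gcdn c q)%N * s)%N ->
  integral_nccc G <->
  exists d : nat, ((gcdn c q - s) ^ 2 + 2 * gcdn c q * (q - gcdn c q) = d ^ 2)%N.
Proof.
move=> nqc homG defG xq y2 xy sE.
have isoG : [set: ext (cyc_twist q_gt1 cK ce)] \isog G.
  rewrite isogEcard homG card_ext card_ord_Zp //= -defG.
  apply: leq_trans (leq_card_joing_index2 _ _) _; last first.
  - by rewrite leq_mul2l /= -orderE dvdn_leq ?(ltnW q_gt1) // order_dvdn xq.
  - by rewrite y2 mem_cycle.
  - by rewrite -groupV inE -cycleJ cycle_subG conjgE invgK mulgA xy mem_cycle.
have nontriv : exists a, cyc_twist q_gt1 cK ce a != a.
  by exists 1%R; rewrite -GRing.subr_eq0 /= mulr1 -natr1 addrK Zp_natr_eq0.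
have := integral_ext isoG nontriv (card_cyc_fix _ _ _) (card_cyc_fix_im _ _ _) sE.
by rewrite card_ord_Zp.
Qed.

Local Close Scope group_scope.
Local Close Scope ring_scope.

(** * The groups D, T and SD *)

Local Open Scope group_scope.

Lemma cyc_rels (q c e : nat) (q_gt1 : (1 < q)%N)
    (cK : (c.+1 * c.+1 = 1 %[mod q])%N) (ce : (q %| c * e)%N) :
  exists x y : ext (cyc_twist q_gt1 cK ce),
    [/\ <[x]> <*> <[y]> = [set: _], x ^+ q = 1, y ^+ 2 = x ^+ e & y * x * y^-1 = x ^+ c.+1].
Proof.
exists (1, false)%R, (0, true)%R; split; rewrite ?ext_expg.
- exact: cyc_gen.
- by congr (_, _); apply/eqP; rewrite Zp_natr_eq0.
- by rewrite expgS expg1 ext_mulE /= mulr0 !add0r.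
- apply: (canLR (mulgK _)).
  by rewrite !ext_mulE /= mulr1 !addr0 add0r.
Qed.

(** [c = q - 2] is the choice for which [c.+1] acts as inversion. *)
Lemma inv_sqr_mod (q : nat) : (1 < q)%N -> ((q - 2).+1 * (q - 2).+1 = 1 %[mod q])%N.
Proof.
move=> q1; have -> : ((q - 2).+1 * (q - 2).+1 = (q - 2) * q + 1)%N by nia.
by rewrite modnMDl.
Qed.

Lemma gcdn_sub2 (q : nat) : (1 < q)%N -> gcdn (q - 2) q = gcdn 2 q.
Proof. by case: q => [|[|r]] // _; rewrite -addn2 addnK gcdnDl gcdnDr gcdnC. Qed.

Lemma integral_D2m (gT : finGroupType) (G : {group gT}) (m s : nat) :
    (2 < m)%N -> is_D2m G m -> gcdn 2 m = (gcdn (gcdn 2 m) (m %/ gcdn 2 m)%N * s)%N ->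
  integral_nccc G <->
  exists d : nat, ((gcdn 2 m - s) ^ 2 + 2 * gcdn 2 m * (m - gcdn 2 m) = d ^ 2)%N.
Proof.
move=> m2 hG; have m1 := ltnW m2; rewrite -gcdn_sub2 // => sE.
have ce : (m %| (m - 2) * 0)%N by rewrite muln0 dvdn0.
have xV (hT : finGroupType) (x : hT) : x ^+ m = 1 -> x ^+ (m - 2).+1 = x^-1.
  by move=> xm; apply: (mulgI x); rewrite -expgS mulgV; have -> : (m - 2).+2 = m by lia.
(* Generators satisfying the relations are obtained by applying the universal property to [G], a
   homomorphic image of itself. *)
have [[x y]] := existsP (etrans (esym (hG _ G)) (homg_refl G)).
case/eqP=> defG xm y2 xy.
apply: (integral_cyclic (cK := inv_sqr_mod m1) (ce := ce) (x := x) (y := y)) => //.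
- by rewrite gtnNdvd //; lia.
- have [x' [y' [gen' xm' y2' xy']]] := cyc_rels m1 (inv_sqr_mod m1) ce.
  rewrite hG; apply/existsP; exists (x', y').
  by rewrite /= gen' xm' y2' xy' xV.
- by rewrite xV.
Qed.

Lemma integral_T4m (gT : finGroupType) (G : {group gT}) (m s : nat) :
    (1 < m)%N -> is_T4m G m -> 2 = (gcdn 2 m * s)%N ->
  integral_nccc G <-> exists d : nat, ((2 - s) ^ 2 + 4 * (2 * m - 2) = d ^ 2)%N.
Proof.
move=> m2 hG sE; have m1 : (1 < 2 * m)%N by lia.
have g2 : gcdn (2 * m - 2) (2 * m) = 2.
  by rewrite gcdn_sub2 //; apply/gcdn_idPl/dvdn_mulr.
have ce : (2 * m %| (2 * m - 2) * m)%N.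
  by apply/dvdnP; exists (m - 1)%N; nia.
have xV (hT : finGroupType) (x : hT) : x ^+ (2 * m) = 1 -> x ^+ (2 * m - 2).+1 = x^-1.
  by move=> xm; apply: (mulgI x); rewrite -expgS mulgV; have -> : ((2 * m - 2).+2 = 2 * m)%N by lia.
(* The presentation conjugates by y^-1 and the model by y; inversion being its own inverse, the two
   relations agree. *)
have yV (hT : finGroupType) (x y : hT) : (y^-1 * x * y == x^-1) = (y * x * y^-1 == x^-1).
  rewrite -(mulgA y^-1) -conjgE -{2}[y]invgK -(mulgA y^-1^-1) -conjgE.
  by rewrite (can2_eq (conjgK y) (conjgKV y)) conjVg eq_sym eqg_invLR.
have [[x y]] := existsP (etrans (esym (hG _ G)) (homg_refl G)).
case/eqP=> defG xm y2 /eqP; rewrite yV => /eqP xy.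
have := @integral_cyclic (2 * m) (2 * m - 2) m m1 (inv_sqr_mod m1) ce gT G x y s.
  rewrite g2 mulKn //; apply=> //.
  - by rewrite gtnNdvd //; lia.
  - have [x' [y' [gen' xm' y2' xy']]] := cyc_rels m1 (inv_sqr_mod m1) ce.
    rewrite hG; apply/existsP; exists (x', y').
    have /eqP yx' : y'^-1 * x' * y' == x'^-1 by rewrite yV xy' xV.
    by rewrite /= gen' xm' y2' yx'.
  - by rewrite xV.
Qed.

(** Here x^(2m-1) is the conjugate of x, so [c = 2 * m - 2]. Its gcd with [4 * m] depends on the
    parity of [m], so [z] and [k] stay parameters. *)
Lemma integral_SD8m (gT : finGroupType) (G : {group gT}) (m k z s : nat) :
    (1 < m)%N -> is_SD8m G m -> gcdn (2 * m - 2) (4 * m) = z ->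
    gcdn z (4 * m %/ z)%N = k -> z = (k * s)%N ->
  integral_nccc G <-> exists d : nat, ((z - s) ^ 2 + 2 * z * (4 * m - z) = d ^ 2)%N.
Proof.
move=> m1 hG zE kE; have q1 : (1 < 4 * m)%N by lia.
have cK : ((2 * m - 2).+1 * (2 * m - 2).+1 = 1 %[mod 4 * m])%N.
  have -> : ((2 * m - 2).+1 * (2 * m - 2).+1 = (m - 1) * (4 * m) + 1)%N by nia.
  by rewrite modnMDl.
have ce : (4 * m %| (2 * m - 2) * 0)%N by rewrite muln0 dvdn0.
have c1 : (2 * m - 2).+1 = (2 * m - 1)%N by lia.
have yV (hT : finGroupType) (y : hT) : y ^+ 2 = 1 -> y^-1 = y.
  by move=> y2; apply/eqP; rewrite eq_invg_mul -expg2 y2.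
have [[x y]] := existsP (etrans (esym (hG _ G)) (homg_refl G)).
case/eqP=> defG xm y2 xy.
have := @integral_cyclic (4 * m) (2 * m - 2) 0 q1 cK ce gT G x y s.
rewrite zE kE c1; apply=> //.
- by rewrite gtnNdvd //; lia.
- have [x' [y' [gen' xm' y2' xy']]] := cyc_rels q1 cK ce.
  rewrite hG; apply/existsP; exists (x', y').
  by rewrite /= gen' xm' y2' -c1 -xy' yV.
- by rewrite yV.
Qed.

Local Close Scope group_scope.

(** * The groups U *)

HB.instance Definition _ (A B : finZmodType) := Finite.on (A * B)%type.

Local Open Scope ring_scope.

Lemma Zp_pred_opp (m : nat) : (1 < m)%N -> (m - 2).+1%:R = -1 :> 'Z_m.
Proof.
move=> m1; apply/eqP; rewrite -addr_eq0 natr1 Zp_natr_eq0 //.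
by rewrite (_ : (m - 2).+2 = m) //; lia.
Qed.

(* The base is generated by x^2 and y: it is x that lies outside it. *)
Section UTwist.
Variables (n m : nat).
Hypotheses (n_gt1 : (1 < n)%N) (m_gt1 : (1 < m)%N).

Let inv_twist : twist 'Z_m :=
  cyc_twist m_gt1 (inv_sqr_mod m_gt1) (dvdn_mull (m - 2) (dvdn0 m)).

Let umap (u : 'Z_n * 'Z_m) : 'Z_n * 'Z_m := (u.1, inv_twist u.2).

Fact u_twistD : {morph umap : a b / a + b}.
Proof. by move=> a b; rewrite /umap /= mulrDr. Qed.
Fact u_twistK : involutive umap.
Proof. by case=> a b; congr (_, _); apply: (twK inv_twist b). Qed.
Fact u_twist_fix : umap (1, 0) = (1, 0).
Proof. by rewrite /umap /= mulr0. Qed.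
Definition u_twist : twist ('Z_n * 'Z_m)%type := Twist u_twistD u_twistK u_twist_fix.

Lemma card_u_fix : #|[set a | u_twist a == a]| = (n * gcdn 2 m)%N.
Proof.
transitivity (#|[set: 'Z_n]| * #|[set b | inv_twist b == b]|)%N; last first.
  by rewrite cardsT card_ord_Zp // card_cyc_fix gcdn_sub2.
rewrite -cardsX; apply: eq_card => -[a b].
by rewrite !inE /= xpair_eqE eqxx.
Qed.

(** The twist is trivial on the first factor, so the image of p - 1 is confined to the second, where
    the twist is inversion. *)
Lemma card_u_fix_im :
  #|[set a | (u_twist a == a) && [exists b, a == u_twist b - b]]|
    = gcdn (gcdn 2 m) (m %/ gcdn 2 m)%N.
Proof.
transitivity (#|[set 0%R : 'Z_n]|
    * #|[set b | (inv_twist b == b) && [exists d, b == (inv_twist d - d)%R]]|)%N; last first.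
  by rewrite cards1 mul1n card_cyc_fix_im gcdn_sub2.
rewrite -cardsX; apply: eq_card => -[a b].
rewrite !inE /= xpair_eqE eqxx andbCA; congr (_ && _).
apply/existsP/andP => [[[c d] /eqP[-> ->]] | [/eqP-> /existsP[d /eqP->]]].
  by rewrite subrr eqxx; split=> //; apply/existsP; exists d.
by exists (0, d); rewrite -[X in (X, _)](subrr 0).
Qed.

End UTwist.

Local Open Scope group_scope.

Lemma leq_card_joing_cycles (gT : finGroupType) (x y : gT) (p q : nat) :
    commute x y -> (0 < p)%N -> (0 < q)%N -> x ^+ p = 1 -> y ^+ q = 1 ->
  (#|<[x]> <*> <[y]>| <= p * q)%N.
Proof.
move=> xy p0 q0 xp yq.
rewrite cent_joinEr; last by rewrite cycle_subG /= cent_cycle; apply/cent1P.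
apply: leq_trans (_ : #|<[x]>| * #|<[y]>| <= _)%N.
  by rewrite mul_cardG leq_pmulr // cardG_gt0.
by rewrite leq_mul // dvdn_leq // order_dvdn ?xp ?yq.
Qed.

Lemma u_rels (n m : nat) (n_gt1 : (1 < n)%N) (m_gt1 : (1 < m)%N) :
  exists x y : ext (u_twist n m_gt1),
    [/\ <[x]> <*> <[y]> = [set: _], x ^+ (2 * n) = 1, y ^+ m = 1 & x^-1 * y * x = y^-1].
Proof.
pose x : ext (u_twist n m_gt1) := (0, true)%R.
pose y : ext (u_twist n m_gt1) := ((0, 1), false)%R.
have x2 : x ^+ 2 = ((1, 0), false)%R.
  by rewrite expgS expg1 ext_mulE /= mulr0 !add0r.
exists x, y; split.
- apply: (ext_gen (b := 0%R)) => [[a b]|]; last by rewrite mem_gen // inE cycle_id.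
  have -> : ((a, b), false) = (x ^+ 2) ^+ a * y ^+ b.
    rewrite x2 !ext_expg ext_mulE /= addr0; congr (_, _); rewrite !pairMnE /=.
    by rewrite !natr_Zp !mul0rn -[RHS]/(a + 0, 0 + b)%R addr0 add0r.
  by rewrite groupM ?groupX ?mem_gen ?inE ?cycle_id ?orbT.
- rewrite expgM x2 ext_expg pairMnE /= mul0rn.
  by have /eqP-> : (n%:R == 0 :> 'Z_n)%R by rewrite Zp_natr_eq0.
- rewrite ext_expg pairMnE /= mul0rn.
  by have /eqP-> : (m%:R == 0 :> 'Z_m)%R by rewrite Zp_natr_eq0.
- rewrite -mulgA; apply: (canLR (mulKg _)); rewrite !ext_mulE ext_invE /=.
  by rewrite Zp_pred_opp // mulrNN mulr1 oppr0 !addr0 add0r.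
Qed.

(** Conjugation by x inverts y, so x^2 commutes with y; the base generated by x^2 and y has order at
    most [n * m], and x normalizes it. *)
Lemma integral_Unm (gT : finGroupType) (G : {group gT}) (n m s : nat) :
    (1 < n)%N -> (2 < m)%N -> is_Unm G n m ->
    (n * gcdn 2 m = gcdn (gcdn 2 m) (m %/ gcdn 2 m)%N * s)%N ->
  integral_nccc G <->
  exists d : nat,
    ((n * gcdn 2 m - s) ^ 2 + 2 * (n * gcdn 2 m) * (n * m - n * gcdn 2 m) = d ^ 2)%N.
Proof.
move=> n1 m2 hG sE; have m1 := ltnW m2.
have [[x y]] := existsP (etrans (esym (hG _ G)) (homg_refl G)).
case/eqP=> defG x2n ym yx.
have yxJ : y ^ x = y^-1 by rewrite conjgE mulgA.
have x2y : commute (x ^+ 2) y.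
  apply/commute_sym/commgP/conjg_fixP.
  by rewrite expgS expg1 conjgM yxJ conjVg yxJ invgK.
have card_V : #|{: 'Z_n * 'Z_m}| = (n * m)%N by rewrite card_prod !card_ord_Zp.
have homG : [set: ext (u_twist n m1)] \homg G.
  have [x' [y' [gen' x2n' ym' yx']]] := u_rels n1 m1.
  by rewrite hG; apply/existsP; exists (x', y'); rewrite /= gen' x2n' ym' yx'.
have isoG : [set: ext (u_twist n m1)] \isog G.
  rewrite isogEcard homG card_ext card_V -defG.
  have le_H : (#|<[x ^+ 2]> <*> <[y]>| <= n * m)%N.
    by apply: leq_card_joing_cycles; rewrite -?expgM //; lia.
  apply: leq_trans (_ : 2 * #|<[x ^+ 2]> <*> <[y]>| <= _)%N; last by rewrite leq_mul2l.
  apply: leq_trans (leq_card_joing_index2 (y := x) _ _).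
  - rewrite subset_leq_card // join_subG joing_subr.
    by rewrite (subset_trans (joing_subr <[x ^+ 2]> _)) ?joing_subl.
  - have /subsetP : <[x]> \subset 'N(<[x ^+ 2]> <*> <[y]>); last by apply; apply: cycle_id.
    apply: normsY; rewrite cycle_subG; first by rewrite (subsetP (cent_sub _)) ?cent_cycle //; apply/cent1P/commuteX.
    by rewrite inE -cycleJ yxJ cycleV.
  - by rewrite mem_gen // inE cycle_id.
have nontriv : exists a, u_twist n m1 a != a.
  exists (0, 1)%R; rewrite xpair_eqE /= mulr1 Zp_pred_opp //.
  by rewrite eq_sym -subr_eq0 opprK -[(1 + 1)%R]/(2%:R)%R Zp_natr_eq0 // gtnNdvd.
have := integral_ext isoG nontriv (card_u_fix n1 m1) (card_u_fix_im n m1) sE.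
by rewrite card_V.
Qed.

Local Close Scope group_scope.
Local Close Scope ring_scope.

(** * The groups V *)

Local Open Scope ring_scope.

Lemma oppZ2 (j : 'Z_2) : - j = j.
Proof. by case: j => [[|[|//]] ?]; apply: val_inj. Qed.

(* The base is generated by x and y^2, with y x y^-1 = x^-1 y^-2. *)
Section VTwist.
Variable m : nat.
Hypothesis m2_gt1 : (1 < 2 * m)%N.

(** Reduction modulo 2, additive because 2 divides [2 * m]. It is the exponent of y^2 that appears
    when y conjugates x^i. *)
Definition par (i : 'Z_(2 * m)) : 'Z_2 := (nat_of_ord i)%:R.

Lemma par_nat (k : nat) : par k%:R = k%:R.
Proof.
apply/eqP; rewrite /par Zp_natr_eq // Zp_nat /= Zp_cast //.
by rewrite modn_dvdm // dvdn_mulr.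
Qed.

Lemma parD : {morph par : a b / a + b}.
Proof. by move=> a b; rewrite -[a]natr_Zp -[b]natr_Zp -natrD !par_nat natrD. Qed.

Lemma par0 : par 0 = 0. Proof. by []. Qed.

Lemma parN (a : 'Z_(2 * m)) : par (- a) = par a.
Proof. by apply: (addIr (par a)); rewrite -parD addNr par0 -{1}[par a]oppZ2 addNr. Qed.

Let vmap (u : 'Z_(2 * m) * 'Z_2) : 'Z_(2 * m) * 'Z_2 := (- u.1, par u.1 + u.2).

Fact v_twistD : {morph vmap : a b / a + b}.
Proof. by move=> a b; rewrite /vmap /= opprD parD addrACA. Qed.
Fact v_twistK : involutive vmap.
Proof. by case=> a b; rewrite /vmap /= opprK addrA -parD addNr par0 add0r. Qed.
Fact v_twist_fix : vmap (0, 1) = (0, 1).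
Proof. by rewrite /vmap /= oppr0 par0 add0r. Qed.
Definition v_twist : twist ('Z_(2 * m) * 'Z_2)%type := Twist v_twistD v_twistK v_twist_fix.

Lemma v_fixE i j : (v_twist (i, j) == (i, j)) = (lcmn m 2 %| i)%N.
Proof.
rewrite xpair_eqE /= dvdn_lcm; congr (_ && _).
  rewrite eq_sym -subr_eq0 opprK -mulr2n -mulr_natl Zp_ker_mul //.
  by rewrite (gcdn_idPl _) ?dvdn_mulr // mulKn.
by rewrite -subr_eq0 addrK /par Zp_natr_eq0.
Qed.

Lemma card_v_fix : #|[set a | v_twist a == a]| = (2 * gcdn m 2)%N.
Proof.
have l0 : (0 < lcmn m 2)%N by rewrite lcmn_gt0; lia.
transitivity (#|[set i : 'Z_(2 * m) | (lcmn m 2 %| i)%N]| * #|[set: 'Z_2]|)%N.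
  by rewrite -cardsX; apply: eq_card => -[i j]; rewrite in_setX !inE andbT v_fixE.
have lg : (lcmn m 2 * gcdn m 2 = 2 * m)%N by rewrite muln_lcm_gcd mulnC.
have dl : (lcmn m 2 %| 2 * m)%N by rewrite -lg dvdn_mulr.
by rewrite cardsT card_ord_Zp // card_Zp_dvdn // -lg mulKn // mulnC.
Qed.

(** The image of p - 1 consists of the pairs (-2b, b mod 2), and fixed pairs have i even and
    divisible by m. The two elements differ with the parity of m: (0, 0) and (0, 1) for m odd, (0,
    0) and (m, m/2 mod 2) for m even. *)
Lemma card_v_fix_im :
  #|[set a | (v_twist a == a) && [exists b, a == v_twist b - b]]| = 2.
Proof.
have imE i j : [exists b, (i, j) == v_twist b - b] = [exists b, (i == - (b + b)) && (j == par b)].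
  apply/existsP/existsP => [[[b c] /eqP[-> ->]] | [b /andP[/eqP-> /eqP->]]].
    by exists b; rewrite opprD addrK !eqxx.
  by exists (b, 0); apply/eqP; congr (_, _); rewrite /= ?opprD // addr0 subr0.
have [odd_m | even_m] := boolP (odd m).
  transitivity (#|[set 0%R : 'Z_(2 * m)]| * #|[set: 'Z_2]|)%N; last first.
    by rewrite cards1 cardsT card_ord_Zp.
  have lE : lcmn m 2 = (2 * m)%N.
    have /eqP g1 : coprime m 2 by rewrite coprimen2.
    by have := muln_lcm_gcd m 2; rewrite g1 muln1 mulnC.
  rewrite -cardsX; apply: eq_card => -[i j].
  rewrite in_setX !inE andbT imE v_fixE lE -Zp_natr_eq0 // natr_Zp.
  (* Twice [j * m] is 0 modulo [2 * m], while its parity is that of [j] because [m] is odd. *)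
  apply/andP/idP => [[]// | /eqP->]; split=> //; apply/existsP; exists (j * m)%:R.
  apply/andP; split.
    by rewrite eq_sym oppr_eq0 -natrD Zp_natr_eq0 // addnn -muln2 -mulnA (mulnC m) dvdn_mull.
  rewrite par_nat natrM natr_Zp.
  have /eqP-> : (m%:R == 1 :> 'Z_2) by rewrite (Zp_natr_eq _ 1) // modn2 odd_m.
  by rewrite mulr1.
have lE : lcmn m 2 = m by apply/lcmn_idPl; rewrite dvdn2.
(* From -2b = i modulo 2m, b is -i/2 modulo m; as m is even this fixes the parity of b, so the
   second coordinate is determined by the first. *)
pose half (i : 'Z_(2 * m)) : 'Z_2 := (i %/ 2)%N%:R.
transitivity #|[set (i, half i) | i in [set i : 'Z_(2 * m) | (m %| i)%N]]|; last first.
  rewrite card_imset => [|i i' [] //]; rewrite card_Zp_dvdn ?dvdn_mull // mulnK //; lia.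
apply: eq_card => -[i j]; rewrite inE imE v_fixE lE.
apply/andP/imsetP => [[mi /existsP[b /andP[ib /eqP->]]] | [i' mi' [-> ->]]].
  exists i; rewrite ?inE //; congr (_, _).
  have i2 : (i %/ 2 * 2 = i)%N by rewrite divnK // (dvdn_trans _ mi) // dvdn2.
  have : (2 * m %| i + (b + b))%N.
    by rewrite -Zp_natr_eq0 // !natrD !natr_Zp (eqP ib) addNr.
  rewrite -i2 addnn -muln2 -mulnDl [((_ + _) * 2)%N]mulnC dvdn_pmul2l // => /(dvdn_trans (_ : 2 %| m)%N).
  rewrite dvdn2 => /(_ even_m); rewrite -Zp_natr_eq0 // natrD addrC addr_eq0 => /eqP E.
  by rewrite /par E oppZ2.
rewrite inE in mi'; split=> //; apply/existsP; exists (- (i' %/ 2)%N%:R).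
rewrite parN par_nat eqxx andbT opprD opprK -natrD addnn -muln2.
by rewrite divnK ?natr_Zp // (dvdn_trans _ mi') // dvdn2.
Qed.

End VTwist.

Local Open Scope group_scope.

Lemma v_rels (m : nat) (m2_gt1 : (1 < 2 * m)%N) :
  exists x y : ext (v_twist m2_gt1),
    [/\ <[x]> <*> <[y]> = [set: _], x ^+ (2 * m) = 1, y ^+ 4 = 1,
        y * x = x^-1 * y^-1 & y^-1 * x = x^-1 * y].
Proof.
pose x : ext (v_twist m2_gt1) := ((1, 0), false)%R.
pose y : ext (v_twist m2_gt1) := (0, true)%R.
have y2 : y ^+ 2 = ((0, 1), false)%R.
  rewrite expgS expg1 ext_mulE; congr (_, _).
  by rewrite -[LHS]/(0 + v_twist m2_gt1 0 + (0, 1))%R tw0 !add0r.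
have par1 : par (1 : 'Z_(2 * m))%R = 1%R by rewrite (par_nat m2_gt1 1).
exists x, y; split.
- apply: (ext_gen (b := 0%R)) => [[a b]|]; last by rewrite mem_gen // inE cycle_id orbT.
  have -> : ((a, b), false) = x ^+ a * (y ^+ 2) ^+ b.
    rewrite y2 !ext_expg ext_mulE /= addr0; congr (_, _); rewrite !pairMnE /=.
    by rewrite !natr_Zp !mul0rn -[RHS]/(a + 0, 0 + b)%R addr0 add0r.
  by rewrite groupM ?groupX ?mem_gen ?inE ?cycle_id ?orbT.
- rewrite ext_expg pairMnE /= mul0rn.
  by have /eqP-> : ((2 * m)%:R == 0 :> 'Z_(2 * m))%R by rewrite Zp_natr_eq0.
- rewrite (expgM y 2 2) y2 ext_expg; congr (_, _).
  by rewrite pairMnE mul0rn; congr (_, _); apply: val_inj.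
- rewrite !ext_mulE !ext_invE /= par1 par0 ?(oppr0, addr0, add0r).
  congr (_, _); apply/eqP; rewrite xpair_eqE /= ?(oppr0, addr0, add0r) eqxx /=.
  by rewrite oppZ2.
- rewrite !ext_mulE !ext_invE /= par1 par0 ?(oppr0, addr0, add0r).
  congr (_, _); apply/eqP; rewrite xpair_eqE /= ?(oppr0, addr0, add0r) eqxx /=.
  by rewrite addNr.
Qed.

Lemma integral_V8m (gT : finGroupType) (G : {group gT}) (m : nat) :
    (1 < m)%N -> is_V8m G m ->
  integral_nccc G <->
  exists d : nat,
    ((2 * gcdn m 2 - gcdn m 2) ^ 2
      + 2 * (2 * gcdn m 2) * (2 * m * 2 - 2 * gcdn m 2) = d ^ 2)%N.
Proof.
move=> m1 hG; have m2 : (1 < 2 * m)%N by lia.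
have [[x y]] := existsP (etrans (esym (hG _ G)) (homg_refl G)).
case/eqP=> defG x2m y4 yx yVx.
have y2V : y ^+ 2 = y^-1 ^+ 2.
  apply: (mulgI (y ^+ 2)).
  by rewrite -expgD y4 expgVn mulgV.
(* The relations give y^2 x = x y^-2, and y^4 = 1 identifies y^-2 with y^2. *)
have xy2 : commute x (y ^+ 2).
  have E : y * x^-1 = x * y^-1.
    by apply: (mulgI y^-1); rewrite mulKg mulgA yVx mulgK.
  have y2x : y * y * x = x * (y^-1 * y^-1) by rewrite -mulgA yx mulgA E mulgA.
  by rewrite /commute [LHS](congr1 (mulg x) y2V) [RHS]y2x.
have card_V : #|{: 'Z_(2 * m) * 'Z_2}| = (2 * m * 2)%N by rewrite card_prod !card_ord_Zp.
have homG : [set: ext (v_twist m2)] \homg G.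
  have [x' [y' [gen' x2m' y4' yx' yVx']]] := v_rels m2.
  by rewrite hG; apply/existsP; exists (x', y'); rewrite /= gen' x2m' y4' yx' yVx'.
have isoG : [set: ext (v_twist m2)] \isog G.
  rewrite isogEcard homG card_ext card_V -defG.
  have le_H : (#|<[x]> <*> <[y ^+ 2]>| <= 2 * m * 2)%N.
    by apply: leq_card_joing_cycles; rewrite -?expgM //; lia.
  apply: leq_trans (_ : 2 * #|<[x]> <*> <[y ^+ 2]>| <= _)%N; last by rewrite leq_mul2l.
  apply: leq_trans (leq_card_joing_index2 (y := y) _ _).
  - rewrite subset_leq_card // join_subG joing_subr andbT.
    by rewrite (subset_trans (joing_subl _ <[y ^+ 2]>)) ?joing_subl.
  - rewrite -groupV inE conjYg -!cycleJ join_subG !cycle_subG.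
    rewrite [(y ^+ 2) ^ _]conjXg conjgE invgK mulgA yx -mulgA conjgE mulgV mulg1 invgK.
    rewrite -[(y^-1 * y^-1)]/(y^-1 ^+ 2) -y2V andbC.
    have Hx : x \in <[x]> <*> <[y ^+ 2]> by rewrite mem_gen // inE cycle_id.
    have Hy : y ^+ 2 \in <[x]> <*> <[y ^+ 2]> by rewrite mem_gen // inE cycle_id orbT.
    by rewrite Hy groupM ?groupV.
  - by rewrite mem_gen // inE cycle_id orbT.
have nontriv : exists a, v_twist m2 a != a.
  by exists (1, 0)%R; rewrite v_fixE dvdn_lcm negb_and orbC.
have := integral_ext isoG nontriv (card_v_fix m2) (card_v_fix_im m2) (erefl _).
by rewrite card_V.
Qed.

Local Close Scope group_scope.
Local Close Scope ring_scope.

(** * Arithmetic *)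

Lemma sqrn_mull (k b d : nat) : 0 < k -> k ^ 2 * b = d ^ 2 -> exists a, b = a ^ 2.
Proof.
move=> k0 E; have /dvdnP[a da] : k %| d by rewrite -(@dvdn_pexp2r _ _ 2) // -E dvdn_mulr.
exists a; move: E; rewrite da expnMn mulnC => /eqP.
by rewrite eqn_pmul2r ?expn_gt0 ?k0 // => /eqP.
Qed.

(** Used when Z(G) meets G' trivially: then s = z, the graph is complete bipartite, and only 2 z
    (|A| - z) survives, here with [k] = z. The square root of 2 (m - 1) is even, and [a] is half of
    it. *)
Lemma sqrn_odd_case (m k : nat) : 2 < m -> 0 < k ->
  (exists d, k ^ 2 * (2 * (m - 1)) = d ^ 2) <-> (exists a, 1 <= a /\ m = 2 * a ^ 2 + 1).
Proof.
move=> m2 k0; split=> [[d /(sqrn_mull k0)[b E]] | [a [a1 ->]]]; last first.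
  by exists (k * (2 * a)); rewrite addnK -!mulnn; lia.
have /dvdnP[a ba] : 2 %| b by rewrite dvdn2; move: (congr1 odd E); rewrite oddX oddM /= => <-.
exists a; rewrite ba in E; split; nia.
Qed.

Lemma sqrn_half_odd_case (m k : nat) : 5 < m -> 0 < k ->
  (exists d, k ^ 2 * (m - 2) = d ^ 2) <-> (exists a, 2 <= a /\ m = a ^ 2 + 2).
Proof.
move=> m5 k0; split=> [[d /(sqrn_mull k0)[a E]] | [a [a2 ->]]]; last first.
  by exists (k * a); rewrite addnK expnMn.
by exists a; split; nia.
Qed.

(** After a factor 2 is taken out, 2 m = 2 (m - 1) + 2 reduces the gcd of m - 1 and 2 m to that of m
    - 1 and 2. *)
Lemma gcdn_SD (m : nat) : 0 < m -> gcdn (2 * m - 2) (4 * m) = 2 * gcdn (m - 1) 2.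
Proof.
move=> m0; rewrite -(gcdnMDl 2 (m - 1) 2) muln_gcdr; congr gcdn; lia.
Qed.

Theorem theorem3p1 :
  (* (1) *)
  (forall m : nat, 3 <= m -> odd m ->
     let P := exists a : nat, 1 <= a /\ m = 2 * a ^ 2 + 1 in
     (forall (gT : finGroupType) (G : {group gT}),
         is_D2m G m -> (integral_nccc G <-> P)) /\
     (forall (gT : finGroupType) (G : {group gT}),
         is_T4m G m -> (integral_nccc G <-> P)) /\
     (forall (n : nat) (gT : finGroupType) (G : {group gT}), 2 <= n ->
         is_Unm G n m -> (integral_nccc G <-> P)) /\
     (forall (gT : finGroupType) (G : {group gT}),
         is_SD8m G m -> (integral_nccc G <-> P))) /\
  (* (2) *)
  (forall m : nat, 6 <= m -> ~~ odd m -> odd (m./2) ->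
     let P := exists a : nat, 2 <= a /\ m = a ^ 2 + 2 in
     (forall (gT : finGroupType) (G : {group gT}),
         is_D2m G m -> (integral_nccc G <-> P)) /\
     (forall (n : nat) (gT : finGroupType) (G : {group gT}), 2 <= n ->
         is_Unm G n m -> (integral_nccc G <-> P))) /\
  (* (3) *)
  (forall m : nat, 4 <= m -> ~~ odd m -> ~~ odd (m./2) ->
     forall (gT : finGroupType) (G : {group gT}),
       is_D2m G m -> (integral_nccc G <-> exists k : nat, 4 * m - 7 = k ^ 2)) /\
  (* (4) *)
  (forall m : nat, 2 <= m -> ~~ odd m ->
     (forall (gT : finGroupType) (G : {group gT}),
         is_T4m G m -> (integral_nccc G <-> exists k : nat, 8 * m - 7 = k ^ 2)) /\
     (forall (gT : finGroupType) (G : {group gT}),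
         is_SD8m G m -> (integral_nccc G <-> exists k : nat, 16 * m - 7 = k ^ 2))) /\
  (* (5) *)
  (forall m : nat, 2 <= m -> ~~ odd m ->
     forall (gT : finGroupType) (G : {group gT}),
       is_V8m G m -> (integral_nccc G <-> exists k : nat, 8 * m - 7 = k ^ 2)) /\
  (forall m : nat, 3 <= m -> odd m ->
     forall (gT : finGroupType) (G : {group gT}),
       is_V8m G m -> (integral_nccc G <-> exists k : nat, 16 * m - 7 = k ^ 2)).

Proof.
split; [|split; [|split; [|split; [|split]]]].
- move=> m m3 odd_m /=; have g2 : gcdn 2 m = 1 by apply/eqP; rewrite -/(coprime 2 m) coprime2n.
  split; [|split; [|split]] => [gT G hG | gT G hG | n gT G n2 hG | gT G hG].
  + have := integral_D2m (s := 1) m3 hG; rewrite g2 gcd1n => /(_ erefl) ->.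
    have <- := @sqrn_odd_case m 1 m3 isT.
    by rewrite subnn /= exp1n mul1n.
  + have -> := integral_T4m (s := 2) (ltnW m3) hG; last by rewrite g2.
    have <- := @sqrn_odd_case m 2 m3 isT.
    by rewrite (_ : 4 * (2 * m - 2) = 2 ^ 2 * (2 * (m - 1))) //; lia.
  + have := integral_Unm (s := n) n2 m3 hG; rewrite g2 gcd1n muln1 mul1n => /(_ erefl) ->.
    have <- := @sqrn_odd_case m n m3 (ltnW n2).
    by rewrite subnn (_ : 2 * n * (n * m - n) = n ^ 2 * (2 * (m - 1))) //; nia.
  + have gE : gcdn (2 * m - 2) (4 * m) = 4.
      rewrite gcdn_SD; last lia.
      by rewrite (gcdn_idPr _) // dvdn2 oddB ?odd_m //; lia.
    have := integral_SD8m (s := 4) (k := 1) (ltnW m3) hG gE.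
    rewrite mulKn // => -> //; last first.
      by apply/eqP; rewrite -/(coprime 4 m) (@coprime_pexpl 2 2) // coprime2n.
    have <- := @sqrn_odd_case m 4 m3 isT.
    by rewrite subnn (_ : 2 * 4 * (4 * m - 4) = 4 ^ 2 * (2 * (m - 1))) //; lia.
- move=> m m6 even_m odd_m2 /=.
  have g2 : gcdn 2 m = 2 by apply/gcdn_idPl; rewrite dvdn2.
  have g1 : gcdn 2 (m %/ 2) = 1 by apply/eqP; rewrite -/(coprime 2 _) coprime2n divn2.
  have m3 : 2 < m by lia.
  split=> [gT G hG | n gT G n2 hG].
  + have := integral_D2m (s := 2) m3 hG; rewrite g2 g1 => /(_ erefl) ->.
    by have <- := @sqrn_half_odd_case m 2 m6 isT.
  + have := integral_Unm (s := n * 2) n2 m3 hG; rewrite g2 g1 mul1n => /(_ erefl) ->.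
    have <- := @sqrn_half_odd_case m (2 * n) m6 (ltac:(lia)).
    rewrite subnn (_ : 2 * (n * 2) * (n * m - n * 2) = (2 * n) ^ 2 * (m - 2)) //; nia.
(* With m/2 even the centre, of order 2, lies in G', so s = 1 and the square (z - s)^2 = 1 no longer
   vanishes. *)
- move=> m m4 even_m even_m2 gT G hG.
  have g2 : gcdn 2 m = 2 by apply/gcdn_idPl; rewrite dvdn2.
  have g1 : gcdn 2 (m %/ 2) = 2 by apply/gcdn_idPl; rewrite divn2 dvdn2.
  have := integral_D2m (s := 1) (ltnW m4) hG; rewrite g2 g1 => /(_ erefl) ->.
  by rewrite (_ : (2 - 1) ^ 2 + 2 * 2 * (m - 2) = 4 * m - 7) //; lia.
- move=> m m2 even_m; have g2 : gcdn 2 m = 2 by apply/gcdn_idPl; rewrite dvdn2.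
  split=> gT G hG.
  + have -> := integral_T4m (s := 1) m2 hG; last by rewrite g2.
    by rewrite (_ : (2 - 1) ^ 2 + 4 * (2 * m - 2) = 8 * m - 7) //; lia.
  + have gE : gcdn (2 * m - 2) (4 * m) = 2.
      rewrite gcdn_SD; last lia.
      rewrite (_ : gcdn (m - 1) 2 = 1) //; apply/eqP.
      by rewrite -/(coprime _ 2) coprimen2 oddB ?(negPf even_m) // ltnW.
    have -> := integral_SD8m (s := 1) (k := 2) m2 hG gE _ erefl; last first.
      by apply/gcdn_idPl; rewrite -[4]/(2 * 2) -mulnA mulKn // dvdn_mulr.
    by rewrite (_ : (2 - 1) ^ 2 + 2 * 2 * (4 * m - 2) = 16 * m - 7) //; lia.
(* Here z = 4 and s = 2, so the discriminant carries a factor 4 that has to be cancelled; for odd m,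
   z = 2 and s = 1 leave no such factor. *)
- move=> m m2 even_m gT G hG; have g2 : gcdn m 2 = 2 by apply/gcdn_idPr; rewrite dvdn2.
  have -> := integral_V8m m2 hG; rewrite g2.
  rewrite (_ : (2 * 2 - 2) ^ 2 + 2 * (2 * 2) * (2 * m * 2 - 2 * 2) = 2 ^ 2 * (8 * m - 7)); last lia.
  split=> [[d /(@sqrn_mull 2 _ _ isT)] | [k ->]] //.
  by exists (2 * k); rewrite expnMn.
- move=> m m3 odd_m gT G hG.
  have g2 : gcdn m 2 = 1 by apply/eqP; rewrite -/(coprime m 2) coprimen2.
  have -> := integral_V8m (ltnW m3) hG; rewrite g2.
  by rewrite (_ : (2 * 1 - 1) ^ 2 + 2 * (2 * 1) * (2 * m * 2 - 2 * 1) = 16 * m - 7) //; lia.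
Qed.
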